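(* Assume that $F$ is $\mu$-strongly convex with $\mu>0$ and that $f(\cdot;\xi)$ is $L$-smooth for every realization of $\xi$ (the functions $f(\cdot;\xi)$ need not be convex). Let $w_*=\arg\min_wF(w)$, $\kappa=\frac{L}{\mu}$ and $N=2\mathbb{E}[\|\nabla f(w_*;\xi)\|^2]$, with $0<N<\infty$. Let $\alpha=2$ and $E=\frac{2\alpha L\kappa}{\mu}$. Consider the SGD iteration $w_{t+1}=w_t-\eta_t\nabla f(w_t;\xi_t)$, $t\ge0$, with stepsizes $\eta_t=\frac{\alpha}{\mu(t+E)}\le\eta_0=\frac{1}{2L\kappa}$. Then $$\mathbb{E}[\|w_t-w_*\|^2]\le\frac{4\alpha^2N}{\mu^2}\,\frac{1}{t-T+E}$$ for all $$t\ge T=\frac{4L\kappa}{\mu}\max\Big\{\frac{L\kappa\mu}{N}\|w_0-w_*\|^2,\,1\Big\}-\frac{4L\kappa}{\mu}.$$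
   Context: $\xi$ is a random variable, $f(\cdot;\xi):\mathbb{R}^d\to\mathbb{R}$ is differentiable for every realization of $\xi$, $F(w)=\mathbb{E}[f(w;\xi)]$, and $\mathbb{E}[\nabla f(w;\xi)]=\nabla F(w)$ for every fixed $w\in\mathbb{R}^d$. The norm is Euclidean. $\mu$-strong convexity of $F$: $F(w)-F(w')\ge\langle\nabla F(w'),w-w'\rangle+\frac{\mu}{2}\|w-w'\|^2$ for all $w,w'\in\mathbb{R}^d$. $L$-smoothness of $f(\cdot;\xi)$ (with $L>0$ independent of the realization): $\|\nabla f(w;\xi)-\nabla f(w';\xi)\|\le L\|w-w'\|$ for all $w,w'$. In the SGD method, $w_0\in\mathbb{R}^d$ is a given (deterministic) initial point and $\xi_0,\xi_1,\dots$ are i.i.d. copies of $\xi$. *)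

(* Defs.v *)
From HB Require Import structures.
From mathcomp Require Import all_boot all_order all_algebra.
From mathcomp Require Import finmap.
From mathcomp Require Import all_classical all_reals all_analysis.

Set Implicit Arguments.
Unset Strict Implicit.
Unset Printing Implicit Defensive.

Import Order.TTheory GRing.Theory Num.Theory.
Import numFieldNormedType.Exports.

Local Open Scope classical_set_scope.
Local Open Scope ring_scope.

(* The library norm on 'rV[R]_d is the sup norm, so the Euclidean structure is
   defined here; both norms induce the same topology, hence the same
   differentiable functions and the same differentials. *)
Definition inner (R : realType) (d : nat) (u v : 'rV[R]_d) : R :=
  \sum_(i < d) u 0 i * v 0 i.

Definition enorm (R : realType) (d : nat) (u : 'rV[R]_d) : R :=
  Num.sqrt (inner u u).

(* The vector of partial derivatives; it represents the differential of g at w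
   when g is differentiable at w. *)
Definition grad (R : realType) (d : nat) (g : 'rV[R]_d -> R) (w : 'rV[R]_d) :
    'rV[R]_d :=
  \row_(i < d) 'D_(delta_mx 0 i) g w.

Definition strongly_convex (R : realType) (d : nat) (mu : R)
    (F : 'rV[R]_d -> R) : Prop :=
  forall w w' : 'rV[R]_d,
    F w - F w' >= inner (grad F w') (w - w') + mu / 2 * enorm (w - w') ^+ 2.

Definition smooth (R : realType) (d : nat) (L : R) (g : 'rV[R]_d -> R) : Prop :=
  forall w w' : 'rV[R]_d, enorm (grad g w - grad g w') <= L * enorm (w - w').

Definition mutually_independent (R : realType) (dO dX : measure_display)
    (Omega : measurableType dO) (X : measurableType dX) (P : probability Omega R)
    (I : choiceType) (xi : I -> {RV P >-> X}) : Prop :=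
  forall (J : {fset I}) (A : I -> set X),
    (forall j, j \in J -> measurable (A j)) ->
    (P (\bigcap_(j in [set` J]) (xi j @^-1` A j)) =
       \prod_(j <- J) P (xi j @^-1` A j))%E.

(* Laws are compared on measurable sets only: the library's pushforward is a
   function on all sets, with no meaning on the nonmeasurable ones. *)
Definition iid_copies (R : realType) (dO dX : measure_display)
    (Omega : measurableType dO) (X : measurableType dX) (P : probability Omega R)
    (I : choiceType) (xi : {RV P >-> X}) (xis : I -> {RV P >-> X}) : Prop :=
  mutually_independent xis /\
  forall i (A : set X), measurable A ->
    distribution P (xis i) A = distribution P xi A.

(* Main.v *)
Require Import Defs.
From HB Require Import structures.
From mathcomp Require Import all_boot all_order all_algebra.
From mathcomp Require Import finmap.
From mathcomp Require Import all_classical all_reals all_analysis.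
From mathcomp Require Import measurable_realfun ring lra.

Set Implicit Arguments.
Unset Strict Implicit.
Unset Printing Implicit Defensive.

Import Order.TTheory GRing.Theory Num.Theory.
Import numFieldNormedType.Exports.

Local Open Scope classical_set_scope.
Local Open Scope ring_scope.

(* Write y_t = E |w_t - wstar|^2.  For a fixed v, smoothness gives
   |grad f(v)|^2 <= 2 L^2 |v - wstar|^2 + 2 |grad f(wstar)|^2, and strong
   convexity gives <grad F(v), v - wstar> >= mu |v - wstar|^2; since
   2 L^2 eta_t <= mu, one step from v has mean square error at most
   (1 - mu eta_t) |v - wstar|^2 + eta_t^2 N.  As w_t depends on xi_0, ...,
   xi_{t-1} only, independence turns this into, with s = t + E and
   b = 4 N / mu^2, y_{t+1} <= (1 - 2 / s) y_t + b / s^2.  Multiplying by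
   s (s - 1) telescopes to (s - 1) (s - 2) y_t <= (E - 1) (E - 2) y_0 + b t,
   and E y_0 <= b M with T = E (M - 1), so that y_t <= 2 b / s once t >= T. *)

(** * Solving the scalar recursion *)

Lemma diminishing_step_rate (R : realFieldType) (y : nat -> R) (E b M : R) :
  4 <= E -> 0 <= b -> 1 <= M -> 0 <= y 0%N -> E * y 0%N <= b * M ->
  (forall t, y t.+1 <= (1 - 2 / (t%:R + E)) * y t + b / (t%:R + E) ^+ 2) ->
  forall t, E * (M - 1) <= t%:R -> y t <= 4 * b / (t%:R - E * (M - 1) + E).
Proof.
move=> E4 b0 M1 y0 yM rec t tT.
(* Multiplying by (s - 1) (s - 2), with s = t + E, makes the contraction
   factor 1 - 2 / s telescope. *)
have weighted k : (k%:R + E - 1) * (k%:R + E - 2) * y k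
    <= (E - 1) * (E - 2) * y 0%N + b * k%:R.
  elim: k => [|k IH]; first by rewrite !add0r mulr0 addr0.
  have k0 : 0 <= k%:R :> R by exact: ler0n.
  rewrite -natr1; set s := k%:R + E in IH *.
  have s4 : 4 <= s by rewrite /s; lra.
  have /(ler_wpM2l (_ : 0 <= s * (s - 1))) := rec k.
  rewrite -/s => /(_ _)/le_trans h.
  rewrite (_ : k%:R + 1 + E - 1 = s); last by rewrite /s; ring.
  rewrite (_ : k%:R + 1 + E - 2 = s - 1); last by rewrite /s; ring.
  apply: h; first by nra.
  rewrite (_ : s * (s - 1) * _ = (s - 1) * (s - 2) * y k + b * (1 - s^-1));
    last by field; lra.
  (* The noise term adds b (1 - 1 / s) <= b per step, whence the linear growth [b * k]. *)
  have : 0 <= b * s^-1 by rewrite mulr_ge0// invr_ge0; lra.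
  lra.
have t0 : 0 <= t%:R :> R by exact: ler0n.
have := weighted t; set s := t%:R + E => ws.
have s4 : 4 <= s by rewrite /s; lra.
have EMs : E * M <= s by rewrite /s; lra.
have EEM : E <= E * M by nra.
rewrite (_ : t%:R - E * (M - 1) + E = s - E * (M - 1)); last by rewrite /s; ring.
(* The bound reached is [2 * b / s]; the claimed denominator lies between [E] and [s], because
   [E * M <= s] and [1 <= M]. *)
apply: (@le_trans _ _ (2 * b / s)); last first.
  rewrite ler_pdivrMr; last lra.
  rewrite mulrAC ler_pdivlMr; last by rewrite /s; lra.
  have : 0 <= b * (E * (M - 1)) by rewrite mulr_ge0//; lra.
  have : 0 <= b * s by rewrite mulr_ge0//; lra.
  lra.
rewrite ler_pdivlMr; last lra.
have p0 : 0 < (s - 1) * (s - 2) by apply: mulr_gt0; lra.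
rewrite -(ler_pM2l p0).
have E2 : E ^+ 2 * y 0%N <= b * s.
  apply: (@le_trans _ _ (b * (E * M))); first by nra.
  by rewrite ler_wpM2l.
(* For 4 <= E <= s, the ratio (x - 1) (x - 2) / x^2 is no larger at [E] than at [s]; the factor
   [s - E] in the difference shows it. *)
have : (E - 1) * (E - 2) * y 0%N * s ^+ 2 <= b * s * ((s - 1) * (s - 2)).
  apply: (@le_trans _ _ (E ^+ 2 * y 0%N * ((s - 1) * (s - 2)))); last first.
    by rewrite ler_wpM2r// ltW.
  rewrite -subr_ge0 (_ : _ - _ =
    y 0%N * ((s - E) * (3 * s * E - 2 * (s + E)))); last by ring.
  by apply: mulr_ge0 => //; apply: mulr_ge0; [rewrite /s; lra|nra].
have st : t%:R = s - E by rewrite /s; ring.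
rewrite st in ws.
move=> h.
have s0 : 0 < s by lra.
rewrite -(ler_pM2r s0).
have := ler_wpM2r (_ : 0 <= s ^+ 2) ws; rewrite sqr_ge0 => /(_ isT) ws'.
(* With [4 <= E] the two contributions total at most b s (2 s^2 - 7 s + 2), which is below 2 b s (s
   - 1) (s - 2) = b s (2 s^2 - 6 s + 4). *)
have : b * (s - E) * s ^+ 2 <= b * (s - 4) * s ^+ 2.
  by rewrite ler_wpM2r ?sqr_ge0// ler_wpM2l//; lra.
have : 0 <= b * s ^+ 2 by rewrite mulr_ge0 ?sqr_ge0.
have : 0 <= b * s by rewrite mulr_ge0// ltW.
lra.
Qed.

(** * Euclidean inner product, Young's inequality, minimisers *)

Section inner_product.
Context {R : realType} {d : nat}.
Implicit Types u v w : 'rV[R]_d.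

Lemma innerDl u v w : inner (u + v) w = inner u w + inner v w.
Proof.
by rewrite /inner -big_split; apply: eq_bigr => i _; rewrite mxE mulrDl.
Qed.

Lemma innerZl a u v : inner (a *: u) v = a * inner u v.
Proof.
by rewrite /inner mulr_sumr; apply: eq_bigr => i _; rewrite mxE mulrA.
Qed.

Lemma innerC u v : inner u v = inner v u.
Proof. by apply: eq_bigr => i _; rewrite mulrC. Qed.

Lemma innerNl u v : inner (- u) v = - inner u v.
Proof. by rewrite -scaleN1r innerZl mulN1r. Qed.

Lemma innerBl u v w : inner (u - v) w = inner u w - inner v w.
Proof. by rewrite innerDl innerNl. Qed.

Lemma innerBr u v w : inner w (u - v) = inner w u - inner w v.
Proof. by rewrite innerC innerBl !(innerC w). Qed.

Lemma innerZr a u v : inner u (a *: v) = a * inner u v.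
Proof. by rewrite innerC innerZl innerC. Qed.

Lemma inner_ge0 u : 0 <= inner u u.
Proof. by apply: sumr_ge0 => i _; rewrite -expr2 sqr_ge0. Qed.

Lemma enorm_ge0 u : 0 <= enorm u.
Proof. exact: sqrtr_ge0. Qed.

Lemma enorm_sqr u : enorm u ^+ 2 = inner u u.
Proof. by rewrite sqr_sqrtr// inner_ge0. Qed.

Lemma innerB_sqr u v :
  inner (u - v) (u - v) = inner u u - 2 * inner u v + inner v v.
Proof. by rewrite innerBl !innerBr (innerC v u); ring. Qed.

Lemma inner_young c u v : 0 < c ->
  2 * inner u v <= c * inner u u + c^-1 * inner v v.
Proof.
move=> c0; rewrite /inner !mulr_sumr -big_split; apply: ler_sum => i _ /=.
rewrite -subr_ge0 (_ : _ - _ = (c * u 0 i - v 0 i) ^+ 2 / c).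
  by rewrite divr_ge0 ?sqr_ge0// ltW.
by field; lra.
Qed.

Lemma innerD_sqr_le c u v : 0 < c ->
  inner (u + v) (u + v) <= (1 + c) * inner u u + (1 + c^-1) * inner v v.
Proof.
move=> c0; have := inner_young u v c0.
have -> : inner (u + v) (u + v) = inner u u + 2 * inner u v + inner v v.
  by rewrite innerDl 2!(innerC _ (_ + _)) !innerDl (innerC v u); ring.
lra.
Qed.

Lemma innerB_sqrC u v : inner (u - v) (u - v) = inner (v - u) (v - u).
Proof. by rewrite !innerB_sqr (innerC v u); ring. Qed.

Lemma smooth_sqr L (g : 'rV[R]_d -> R) u v : 0 < L -> smooth L g ->
  inner (grad g u - grad g v) (grad g u - grad g v)
    <= L ^+ 2 * inner (u - v) (u - v).
Proof.
move=> L0 /(_ u v) gL; rewrite -!enorm_sqr -exprMn.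
by rewrite ler_pXn2r// nnegrE ?mulr_ge0// ?enorm_ge0// ltW.
Qed.

(** Along each axis the difference quotients at a minimiser are at most 0 from the left and at least
    0 from the right, so their common limit is 0. *)
Lemma grad_min0 (g : 'rV[R]_d -> R) v :
  differentiable g v -> (forall u, g v <= g u) -> grad g v = 0.
Proof.
move=> dg vmin; apply/rowP => i; rewrite !mxE.
have := @diff_derivable _ _ _ _ _ (delta_mx 0 i) dg.
rewrite /derivable /derive.
set q := fun h : R => h^-1 *: _ => /cvg_ex[l ql].
have /cvg_lim -> := ql => //.
have incr h : 0 <= (g \o shift v) (h *: delta_mx 0 i) - g v.
  by rewrite subr_ge0 vmin.
apply/eqP; rewrite eq_le; apply/andP; split.
- apply: (cvgr_to_le (cvg_dnbhs_at_left ql)).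
  near=> h; apply: mulr_le0_ge0; last exact: incr.
  by rewrite invr_le0 ltW//; near: h; exact: nbhs_left_lt.
- apply: (cvgr_to_ge (cvg_dnbhs_at_right ql)).
  near=> h; apply: mulr_ge0; last exact: incr.
  by rewrite invr_ge0 ltW//; near: h; exact: nbhs_right_gt.
Unshelve. all: by end_near. Qed.

(** The strong convexity inequalities for (u, v) and (v, u) are added: the values of [F] cancel and
    the two halves of [mu] combine. *)
Lemma strongly_convex_min mu (F : 'rV[R]_d -> R) v u :
  strongly_convex mu F -> grad F v = 0 ->
  mu * inner (u - v) (u - v) <= inner (grad F u) (u - v).
Proof.
move=> Fsc g0; have := Fsc u v; have := Fsc v u.
rewrite !enorm_sqr g0 (innerB_sqrC v u) -(opprB u v) (innerC (grad F u)) innerNl.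
rewrite -[0 : 'rV[R]_d](scale0r 0) innerZl mul0r (innerC (grad F u)).
lra.
Qed.

End inner_product.

(** * Countable grids of shrinking cells *)

Section grid.
Context {R : realType} {d : nat}.
Implicit Types (n k : nat) (v : 'rV[R]_d).

(* The half-open cubes of side 1 / (n + 1) cut R^d into countably many cells;
   a cell is named by a natural number, and numbers that encode no integer
   vector name the empty cell. *)
Definition cell_index n v : 'rV[int]_d := \row_i Num.floor (v 0 i * n.+1%:R).

Definition grid_point n (z : 'rV[int]_d) : 'rV[R]_d :=
  \row_i ((z 0 i)%:~R / n.+1%:R).

Definition cell n k : set 'rV[R]_d := [set v | choice.pickle (cell_index n v) = k].

(** The default 0 is harmless: a number that decodes to no vector names an empty cell. *)
Definition cell_corner n k : 'rV[R]_d :=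
  grid_point n (odflt 0 (choice.unpickle k)).

Lemma cell_cornerE n v :
  cell_corner n (choice.pickle (cell_index n v)) = grid_point n (cell_index n v).
Proof. by rewrite /cell_corner choice.pickleK. Qed.

Lemma cell_corner_close n k v : cell n k v ->
  inner (v - cell_corner n k) (v - cell_corner n k) <= d%:R / n.+1%:R ^+ 2.
Proof.
move=> <-; rewrite cell_cornerE /inner.
rewrite (_ : d%:R / _ = \sum_(i < d) (n.+1%:R ^+ 2)^-1); last first.
  by rewrite sumr_const card_ord -[RHS]mulr_natl.
apply: ler_sum => i _; rewrite !mxE -expr2.
set m := n.+1%:R; have m0 : 0 < m :> R by rewrite ltr0n.
have /andP[fl fu] := floor_itv (v 0 i * m).
have lo : 0 <= v 0 i - (Num.floor (v 0 i * m))%:~R / m.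
  by rewrite subr_ge0 ler_pdivrMr.
rewrite -exprVn ler_pXn2r// ?nnegrE ?invr_ge0 ?ler0n//.
rewrite -(ler_pM2r m0) mulVf ?gt_eqF// mulrBl divfK ?gt_eqF//.
by move: fu; rewrite intrD; lra.
Qed.

Lemma bigcup_cell n : \bigcup_k cell n k = setT.
Proof.
by apply/seteqP; split => // v _; exists (choice.pickle (cell_index n v)).
Qed.

End grid.

(** * Measurability of Lipschitz composites and of gradients *)

Section measurability.
Context {R : realType} {d : nat} {dT dX : measure_display}.
Context {T : measurableType dT} {X : measurableType dX}.

Lemma measurable_cell (V : T -> 'rV[R]_d) n k :
  (forall i, measurable_fun [set: T] (fun t => V t 0 i)) ->
  measurable (V @^-1` cell n k).
Proof.
move=> mV.
have [[z zk]|nok] := pselect (exists z : 'rV[int]_d, choice.pickle z = k);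
  last first.
  rewrite (_ : _ @^-1` _ = set0)// -subset0 => t /= Vt.
  by apply: nok; eexists; exact: Vt.
rewrite (_ : _ @^-1` _ = \bigcap_(i in [set: 'I_d])
   (setT `&` (fun t => V t 0 i) @^-1`
     `[(z 0 i)%:~R / n.+1%:R, (z 0 i + 1)%:~R / n.+1%:R[%classic)).
  by apply: fin_bigcap_measurable => // i _; exact: mV.
apply/seteqP; split => [t /=|t Vt].
  rewrite /cell/= -zk => /(pcan_inj choice.pickleK) <- i _; split => //=.
  rewrite in_itv/= mxE ler_pdivrMr// ltr_pdivlMr//.
  exact: floor_itv.
rewrite /cell/= -zk; congr choice.pickle; apply/rowP => i; rewrite mxE.
have [_/=] := Vt i I.
rewrite in_itv/= ler_pdivrMr// ltr_pdivlMr// => ?.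
by apply/eqP; rewrite floor_eq.
Qed.

(** With [V t] replaced by its cell corner, the composite is measurable on each of countably many
    cells; the Lipschitz bound makes these approximations converge pointwise as the mesh shrinks. *)
Lemma measurable_lipschitz_comp (V : T -> 'rV[R]_d) (xi : T -> X)
    (h : 'rV[R]_d -> X -> R) (K : R) :
  (forall i, measurable_fun [set: T] (fun t => V t 0 i)) ->
  measurable_fun [set: T] xi ->
  (forall v, measurable_fun [set: X] (h v)) ->
  0 <= K ->
  (forall x u v, (h u x - h v x) ^+ 2 <= K * inner (u - v) (u - v)) ->
  measurable_fun [set: T] (fun t => h (V t) (xi t)).
Proof.
move=> mV mxi mh K0 hK.
pose hn n t := h (cell_corner n (choice.pickle (cell_index n (V t)))) (xi t).
apply: (@measurable_fun_cvg _ _ _ _ hn) => [n|t _].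
  rewrite -(preimage_setT V) -(bigcup_cell n) preimage_bigcup.
  apply/measurable_fun_bigcup => k; first exact: measurable_cell.
  apply: (@eq_measurable_fun _ _ _ _ _ (fun t => h (cell_corner n k) (xi t))).
    by move=> t; rewrite inE /= /hn => <-.
  apply: measurable_funTS; exact: measurableT_comp (mh _) mxi.
apply/cvgrPdist_le => e e0.
(* The added 1 gives K d <= C <= C^2, so the squared error is at most (C / (n + 1))^2. *)
pose C := K * d%:R + 1.
have C0 : 1 <= C by rewrite /C lerDr mulr_ge0.
near=> n.
have : (h (V t) (xi t) - hn n t) ^+ 2 <= (C / n.+1%:R) ^+ 2.
  apply: le_trans (hK _ _ _) _.
  apply: (@le_trans _ _ (K * (d%:R / n.+1%:R ^+ 2))).
    by rewrite ler_wpM2l// cell_corner_close.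
  rewrite expr_div_n mulrA ler_wpM2r ?invr_ge0 ?sqr_ge0//.
  by rewrite /C in C0 *; nra.
rewrite -ler_sqrt ?sqr_ge0// !sqrtr_sqr (@ger0_norm _ (C / _)); last first.
  by rewrite divr_ge0//; lra.
move/le_trans; apply.
rewrite ler_pdivrMr// mulrC -ler_pdivrMr//.
near: n; exists (Num.bound (C / e)) => // n /= nb.
apply/ltW/(lt_le_trans (archi_boundP _)); last by rewrite ler_nat ltnW.
by apply: divr_ge0; [rewrite /C; by rewrite addr_ge0// mulr_ge0|exact: ltW].
Unshelve. all: by end_near. Qed.

(** A partial derivative is the pointwise limit of the difference quotients with step 1 / (n + 1),
    each measurable in [x]. *)
Lemma measurable_grad (f : 'rV[R]_d -> X -> R) v i :
  (forall u, measurable_fun [set: X] (f u)) ->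
  (forall x u, differentiable (fun u => f u x) u) ->
  measurable_fun [set: X] (fun x => grad (fun u => f u x) v 0 i).
Proof.
move=> mf df.
pose hn (n : nat) (x : X) :=
  n.+1%:R * (f (n.+1%:R^-1 *: delta_mx 0 i + v) x - f v x).
apply: (@measurable_fun_cvg _ _ _ _ hn) => [n|x _].
  by apply: measurable_funM => //; exact: measurable_funB.
rewrite mxE.
have := @diff_derivable _ _ _ _ _ (delta_mx 0 i) (df x v).
rewrite /derivable /derive; set q := fun h : R => h^-1 *: _ => /cvg_ex[l ql].
have /cvg_lim -> := ql => //.
have /cvg_at_rightP/(_ (fun n => n.+1%:R^-1)) := cvg_dnbhs_at_right ql.
rewrite (_ : (fun n => q _) = hn ^~ x); last first.
  by apply/funext => n /=; rewrite /q /hn invrK.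
apply; split; first by move=> n; rewrite invr_gt0.
exact: cvg_harmonic.
Qed.

End measurability.

(** * Integrating over an event independent of the draw *)

Section freezing.
Local Open Scope ereal_scope.
Context {R : realType} {dO dX : measure_display}.
Context {Omega : measurableType dO} {X : measurableType dX}.
Context {P : probability Omega R}.
Implicit Types (A : set Omega) (B : set X) (phi : X -> \bar R).

Lemma ge0_integral_mrestr A (mA : measurable A) (g : Omega -> \bar R) :
  measurable_fun [set: Omega] g -> (forall x, 0 <= g x) ->
  \int[mrestr P mA]_x g x = \int[P]_(x in A) g x.
Proof.
move=> mg g0; rewrite -(setUv A).
rewrite ge0_integral_setU//; first 1 last.
- exact: measurableC.
- by rewrite setUv.
- by rewrite disj_set2E setICr.
rewrite [X in _ + X]null_set_integral ?adde0//.
- apply: eq_measure_integral => B mB BA.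
  by rewrite /= /mrestr setIidl.
- exact: measurableC.
- exact: measurable_funTS.
- by rewrite /= /mrestr setICl measure0.
Qed.

(** By the product hypothesis, [xi'] pushes [P] restricted to [A] onto [P A] times the law of [xi];
    both sides integrate [phi] against this one measure. *)
Lemma freezing (xi xi' : {RV P >-> X}) A phi : measurable A ->
  (forall B, measurable B ->
    P (A `&` xi' @^-1` B) = P A * distribution P xi B) ->
  measurable_fun [set: X] phi -> (forall x, 0 <= phi x) ->
  \int[P]_(omega in A) phi (xi' omega) = P A * \int[P]_omega phi (xi omega).
Proof.
move=> mA indep mphi phi0.
have PA0 : (0 <= fine (P A))%R by rewrite fine_ge0.
have PA : P A = (NngNum PA0)%:num%:E by rewrite /= fineK// fin_num_measure.
have mg : measurable_fun setT (phi \o xi') by exact: measurableT_comp.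
rewrite -(ge0_integral_mrestr mA mg)//; last by move=> x; exact: phi0.
rewrite -(ge0_integral_distribution xi mphi phi0) PA.
rewrite -ge0_integral_mscale//.
rewrite -[LHS](ge0_integral_pushforward (phi := xi') _ (mrestr P mA) (D := setT))//.
apply: eq_measure_integral => B mB _.
transitivity (P A * distribution P xi B); last exact: (congr1 (fun z => z * _) PA).
by rewrite -indep// setIC.
Qed.

End freezing.

(** * Independence of the current draw from the past *)

Section history.
Local Open Scope ereal_scope.
Context {R : realType} {dO dX : measure_display}.
Context {Omega : measurableType dO} {X : measurableType dX}.
Context {P : probability Omega R}.
Variables (xi : {RV P >-> X}) (xis : nat -> {RV P >-> X}).

(** A pi-system generating the sigma-algebra of the draws with index below [t]; for [t = 0] its only
    member is the whole space. *)
Definition cylinders (t : nat) : set (set Omega) :=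
  [set \bigcap_(j in `I_t) (xis j @^-1` A j)
     | A in [set A : nat -> set X | forall j, measurable (A j)]].

Lemma cylinders_measurable t : cylinders t `<=` measurable.
Proof.
move=> _ [A mA <-]; apply: bigcap_measurableType => j _.
by rewrite -[X in measurable X]setTI; exact: measurable_funP.
Qed.

Lemma cylindersT t : cylinders t setT.
Proof.
exists (fun=> setT); first by move=> j /=.
by apply/seteqP; split.
Qed.

Lemma setI_closed_cylinders t : setI_closed (cylinders t).
Proof.
move=> _ _ [A mA <-] [B mB <-]; exists (fun j => A j `&` B j).
  by move=> j; exact: measurableI.
by rewrite -bigcapI; apply: eq_bigcapr => j _; rewrite preimage_setI.
Qed.

Lemma cylinders_succ t : cylinders t `<=` cylinders t.+1.
Proof.
move=> _ [A mA <-]; exists (fun j => if (j < t)%N then A j else setT).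
  by move=> j; case: ifP.
apply/seteqP; split => omega h j /= jt.
  by have := h j (ltnW jt); rewrite /= jt.
by case: ifPn => // /(h j).
Qed.

Lemma cylinders_last t B : measurable B -> cylinders t.+1 (xis t @^-1` B).
Proof.
move=> mB; exists (fun j => if j == t then B else setT).
  by move=> j; case: ifP.
apply/seteqP; split => [omega h|omega h j /= jt].
  by have := h t (ltnSn t); rewrite /= eqxx.
by case: eqP => // ->.
Qed.

(** Mutual independence is applied to the indices below [t] and to those up to [t]; the two products
    differ by the factor at [t], which is the law of [xi] by identical distribution. *)
Lemma independent_cylinder t C B : iid_copies xi xis ->
  cylinders t C -> measurable B ->
  P (C `&` xis t @^-1` B) = P C * distribution P xi B.
Proof.
move=> [indep same] [A mA <-] mB.
pose J := [fset j in iota 0 t]%fset.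
have JE j : (j \in J) = (j < t)%N by rewrite !inE mem_iota.
have tJ : t \notin J by rewrite JE ltnn.
pose A' j := if j == t then B else A j.
have mA' j : measurable (A' j) by rewrite /A'; case: ifP.
have -> : \bigcap_(j in `I_t) (xis j @^-1` A j)
    = \bigcap_(j in [set` J]) (xis j @^-1` A' j).
  apply/seteqP; split=> omega h j /=; rewrite ?JE => jt.
    by rewrite /A' ltn_eqF//; exact: h.
  by have := h j; rewrite /= JE /A' ltn_eqF//; exact.
rewrite -(same t)// indep; last by move=> *; exact: mA'.
have A't : A' t = B by rewrite /A' eqxx.
have := indep (t |` J)%fset A' (fun j _ => mA' j).
rewrite big_fsetU1//= A't muleC => <-; congr (P _).
apply/seteqP; split => [omega [h ht] j /=|omega h].
  rewrite in_fset1U => /orP[/eqP ->|jJ]; first by rewrite A't.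
  exact: h.
split=> [j jJ|]; first by apply: h; rewrite /= in_fset1U; apply/orP; right.
by rewrite -A't; apply: h; rewrite /= in_fset1U eqxx.
Qed.

Lemma history_measurable t A : <<s cylinders t >> A -> measurable A.
Proof.
apply: smallest_sub; first exact: sigma_algebra_measurable.
exact: cylinders_measurable.
Qed.

(** For fixed [B], both sides are finite measures in [A] that agree on the pi-system of cylinders,
    hence on the sigma-algebra it generates. *)
Lemma independent_history t A B : iid_copies xi xis ->
  <<s cylinders t >> A -> measurable B ->
  P (A `&` xis t @^-1` B) = P A * distribution P xi B.
Proof.
move=> iid sA mB; pose D := xis t @^-1` B.
have mD : measurable D.
  by rewrite -[X in measurable X]setTI; exact: measurable_funP.
have PB0 : (0 <= fine (distribution P xi B))%R by rewrite fine_ge0.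
have PB : distribution P xi B = (NngNum PB0)%:num%:E.
  by rewrite /= fineK// fin_num_measure.
rewrite PB muleC.
apply: (@g_sigma_algebra_measure_unique _ _ _ (cylinders t) _ (fun=> setT) _ _
  (mrestr P mD) (mscale (NngNum PB0) P)) sA => //.
- exact: cylinders_measurable.
- by move=> _; exact: cylindersT.
- by rewrite bigcup_const.
- exact: setI_closed_cylinders.
- move=> C cC; rewrite /= /mrestr /mscale -PB muleC.
  exact: independent_cylinder.
- move=> _; rewrite /= /mrestr setTI.
  exact: (le_lt_trans (probability_le1 P mD)) (ltry _).
Qed.

End history.

(** * Integrals of affine expressions and measurability of squared norms *)

Section affine_integral.
Context {R : realType} {dT : measure_display} {T : measurableType dT}.

Lemma ge0_integral_affine (mu : {measure set T -> \bar R}) (D : set T)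
    (g : T -> R) (a b : R) :
  measurable D -> measurable_fun [set: T] g -> (forall x, 0 <= g x) ->
  0 <= a -> 0 <= b ->
  (\int[mu]_(x in D) (a * g x + b)%:E
   = a%:E * \int[mu]_(x in D) (g x)%:E + b%:E * mu D)%E.
Proof.
move=> mD mg g0 a0 b0.
have mgD : measurable_fun D (EFin \o g).
  by apply: measurable_funTS; exact/measurable_EFinP.
under eq_integral do rewrite EFinD.
rewrite ge0_integralD//.
- rewrite integral_cst//; congr (_ + _)%E.
  under eq_integral do rewrite EFinM.
  by rewrite ge0_integralZl_EFin// => x _; rewrite lee_fin.
- by move=> x _; rewrite lee_fin mulr_ge0.
- apply/measurable_EFinP; apply: measurable_funM => //.
  exact: measurable_funTS.
Qed.

Lemma measurable_inner d (U : T -> 'rV[R]_d) :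
  (forall i, measurable_fun [set: T] (fun t => U t 0 i)) ->
  measurable_fun [set: T] (fun t => inner (U t) (U t)).
Proof. by move=> mU; apply: measurable_sum => i; exact: measurable_funM. Qed.

Lemma sqr_coord_le d (u : 'rV[R]_d) i : u 0 i ^+ 2 <= inner u u.
Proof.
rewrite /inner (bigD1 i)//= expr2 lerDl sumr_ge0// => j _.
by rewrite -expr2 sqr_ge0.
Qed.

End affine_integral.

(** * One random step from an independent random point *)

Section conditional_bound.
Context {R : realType} {d : nat} {dO dX : measure_display}.
Context {Omega : measurableType dO} {X : measurableType dX}.
Context {P : probability Omega R}.
Variables (xi xi' : {RV P >-> X}) (V : Omega -> 'rV[R]_d).
Variables (S : 'rV[R]_d -> X -> 'rV[R]_d) (a : 'rV[R]_d) (K q r : R).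
Hypothesis mV : forall i, measurable_fun [set: Omega] (fun omega => V omega 0 i).
Hypothesis mS : forall v i, measurable_fun [set: X] (fun x => S v x 0 i).
Hypothesis S_lip : forall x u v,
  inner (S u x - S v x) (S u x - S v x) <= K * inner (u - v) (u - v).
Hypothesis cell_indep : forall n k B, measurable B ->
  (P (V @^-1` cell n k `&` xi' @^-1` B)
   = P (V @^-1` cell n k) * distribution P xi B)%E.
Hypotheses (K0 : 0 <= K) (q0 : 0 <= q) (r0 : 0 <= r).
Hypothesis S_mean : forall v,
  (\int[P]_omega (inner (S v (xi omega)) (S v (xi omega)))%:E
   <= (q * inner (v - a) (v - a) + r)%:E)%E.

Let G omega := inner (S (V omega) (xi' omega)) (S (V omega) (xi' omega)).
Let H omega := inner (V omega - a) (V omega - a).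

Lemma measurable_S_comp i :
  measurable_fun [set: Omega] (fun omega => S (V omega) (xi' omega) 0 i).
Proof.
apply: (measurable_lipschitz_comp (h := fun v x => S v x 0 i) mV _ _ K0) => //.
move=> x u v; apply: le_trans (S_lip x u v).
by have := sqr_coord_le (S u x - S v x) i; rewrite !mxE.
Qed.

Let mG : measurable_fun [set: Omega] G.
Proof. by apply: measurable_inner => i; exact: measurable_S_comp. Qed.

Let mH : measurable_fun [set: Omega] H.
Proof.
apply: measurable_inner => i; under eq_fun do rewrite mxE.
by apply: measurable_funD => //; exact: measurable_cst.
Qed.

(** Young's inequality with weight [step n] is used twice, from [V] to the corner and back, which
    gives the two factors in [slope]. As the weight equals the mesh, [slope n] tends to [q] while
    [rho n], of order 1 / n, tends to 0. *)
Let step n := n.+1%:R^-1 : R.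
Let rho n : R := (1 + (step n)^-1) * (d%:R / n.+1%:R ^+ 2).
Let slope n : R := (1 + step n) * q * (1 + step n).
Let offset n : R := (1 + step n) * (q * rho n + r) + K * rho n.

Let step_gt0 n : 0 < step n.
Proof. by rewrite /step invr_gt0. Qed.

Let rho_ge0 n : 0 <= rho n.
Proof.
by rewrite /rho mulr_ge0 ?divr_ge0 ?exprn_ge0// addr_ge0// invr_ge0 ltW.
Qed.

Let slope_ge0 n : 0 <= slope n.
Proof. by rewrite /slope !mulr_ge0// addr_ge0// ltW. Qed.

Let offset_ge0 n : 0 <= offset n.
Proof.
have c1 : 0 <= 1 + step n by rewrite addr_ge0// ltW.
by apply: addr_ge0; apply: mulr_ge0 => //; rewrite addr_ge0// mulr_ge0.
Qed.

(** On one cell, [V] moves to the corner [v] at a Lipschitz cost, [freezing] replaces [xi'] by an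
    average over [xi] that [S_mean] controls, and [v - a] is traded back for [V - a]. *)
Let cell_bound n k :
  (\int[P]_(omega in V @^-1` cell n k) (G omega)%:E
   <= \int[P]_(omega in V @^-1` cell n k) (slope n * H omega + offset n)%:E)%E.
Proof.
set A := V @^-1` cell n k; pose v : 'rV[R]_d := cell_corner n k; set c := step n.
have c0 : 0 < c by exact: step_gt0.
have c1 : 0 <= 1 + c by rewrite addr_ge0// ltW.
have c2 : 0 <= 1 + c^-1 by rewrite addr_ge0// invr_ge0 ltW.
have mA : measurable A by exact: measurable_cell.
pose phi x := inner (S v x) (S v x).
have mphi : measurable_fun [set: X] phi by exact: measurable_inner.
have phi0 x : 0 <= phi x by exact: inner_ge0.
pose beta := (1 + c) * (q * inner (v - a) (v - a) + r) + K * rho n.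
have beta0 : 0 <= beta.
  apply: addr_ge0; apply: mulr_ge0 => //.
  by apply: addr_ge0 => //; rewrite mulr_ge0// inner_ge0.
have close omega :
    A omega -> (1 + c^-1) * inner (V omega - v) (V omega - v) <= rho n.
  move=> Aomega; rewrite ler_wpM2l//.
  exact: cell_corner_close.
have mphiE : measurable_fun [set: X] (EFin \o phi) by exact/measurable_EFinP.
have mphi' : measurable_fun [set: Omega] (phi \o xi').
  exact: measurableT_comp.
apply: (@le_trans _ _
    (\int[P]_(omega in A) ((1 + c) * phi (xi' omega) + K * rho n)%:E)%E).
  apply: ge0_le_integral => //.
  - by move=> omega _; rewrite lee_fin inner_ge0.
  - by apply: measurable_funTS; exact/measurable_EFinP.
  - apply: measurable_funTS; apply/measurable_EFinP.
    by apply: measurable_funD => //; exact: measurable_funM.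
  move=> omega Aomega; rewrite lee_fin /G.
  have -> : S (V omega) (xi' omega)
      = S v (xi' omega) + (S (V omega) (xi' omega) - S v (xi' omega)).
    by rewrite addrC subrK.
  apply: le_trans (innerD_sqr_le _ _ c0) _; rewrite lerD2l.
  apply: (@le_trans _ _ (K * ((1 + c^-1) * inner (V omega - v) (V omega - v)))).
    by rewrite mulrCA ler_wpM2l.
  by rewrite ler_wpM2l// close.
rewrite (@ge0_integral_affine _ _ _ P A (phi \o xi'))//; last 2 first.
- by move=> omega; exact: phi0.
- exact: mulr_ge0.
rewrite [X in (_ * X + _)%E](_ : _ =
    P A * \int[P]_omega (phi (xi omega))%:E)%E; last first.
  apply: (freezing (phi := EFin \o phi)) => //.
  by move=> B mB; exact: cell_indep.
apply: (@le_trans _ _ (\int[P]_(omega in A) beta%:E)%E); last first.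
  apply: ge0_le_integral => //.
    apply: measurable_funTS; apply/measurable_EFinP.
    by apply: measurable_funD => //; exact: measurable_funM.
  move=> omega Aomega; rewrite lee_fin.
  have -> : slope n * H omega + offset n
      = (1 + c) * (q * ((1 + c) * H omega + rho n) + r) + K * rho n.
    by rewrite /slope /offset -/c; ring.
  rewrite lerD2r ler_wpM2l// lerD2r ler_wpM2l//.
  have -> : v - a = (V omega - a) + (v - V omega) by rewrite [RHS]addrC addrA subrK.
  apply: le_trans (innerD_sqr_le _ _ c0) _; rewrite lerD2l innerB_sqrC.
  exact: close.
have pb : 0 <= q * inner (v - a) (v - a) + r.
  by rewrite addr_ge0// mulr_ge0// inner_ge0.
rewrite integral_cst// /beta [X in (_ <= X * _)%E]EFinD.
rewrite [leRHS]ge0_muleDl ?lee_fin ?mulr_ge0//.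
rewrite leeD2r// [X in (_ <= X * _)%E]EFinM -muleA lee_wpmul2l ?lee_fin//.
by rewrite muleC lee_wpmul2r//; exact: S_mean.
Qed.

(* Fubini is avoided: on a cell, [V] is frozen at the corner, where independence
   applies, and the Lipschitz error disappears as the mesh goes to 0. *)
Lemma conditional_bound (y : R) :
  (\int[P]_omega (H omega)%:E = y%:E)%E ->
  (\int[P]_omega (G omega)%:E <= (q * y + r)%:E)%E.
Proof.
move=> Hy.
have y0 : 0 <= y.
  by rewrite -lee_fin -Hy integral_ge0// => omega _; rewrite lee_fin inner_ge0.
have bound n : (\int[P]_omega (G omega)%:E <= (slope n * y + offset n)%:E)%E.
  have split (g : Omega -> R) :
      measurable_fun [set: Omega] g -> (forall omega, 0 <= g omega) ->
      (\int[P]_omega (g omega)%:E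
       = \sum_(k <oo) \int[P]_(omega in V @^-1` cell n k) (g omega)%:E)%E.
    move=> mg g0; rewrite -ge0_integral_bigcup.
    - by rewrite -preimage_bigcup bigcup_cell preimage_setT.
    - by move=> k; exact: measurable_cell.
    - by apply: measurable_funTS; exact/measurable_EFinP.
    - by move=> omega _; rewrite lee_fin.
    - by move=> i j _ _ [omega [/= <- <-]].
  have H0 omega : 0 <= H omega by exact: inner_ge0.
  rewrite (split G)//; last by move=> omega; exact: inner_ge0.
  apply: (@le_trans _ _ (\int[P]_omega (slope n * H omega + offset n)%:E)%E).
    rewrite split.
    - apply: lee_nneseries => [k _ _|k _]; last exact: cell_bound.
      by apply: integral_ge0 => omega _; rewrite lee_fin inner_ge0.
    - by apply: measurable_funD => //; exact: measurable_funM.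
    - by move=> omega; rewrite addr_ge0// mulr_ge0.
  by rewrite (ge0_integral_affine _ (g := H))//= Hy probability_setT mule1.
apply/lee_addgt0Pr => e e0.
(* For c = [step n] <= 1, the excess of [slope n * y + offset n] over [q * y + r] is at most C c, by
   2 c + c^2 <= 3 c, (1 + c) (c^2 + c) <= 4 c and c^2 + c <= 2 c; the final 1 makes [C] positive. *)
pose C := 3 * q * y + r + 4 * q * d%:R + 2 * K * d%:R + 1.
have C0 : 0 < C.
  by rewrite /C ltr_wpDl// !addr_ge0 ?mulr_ge0.
pose n := Num.bound (C / e).
apply: le_trans (bound n) _; rewrite -EFinD lee_fin.
have ce : C * step n <= e.
  rewrite /step ler_pdivrMr// mulrC -ler_pdivrMr//.
  apply/ltW/(lt_le_trans (archi_boundP _)); first by rewrite divr_ge0// ltW.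
  by rewrite ler_nat.
rewrite -lerBlDl; apply: le_trans ce.
have c0 := step_gt0 n; have c1 : step n <= 1 by rewrite /step invf_le1// ler1n.
have rhoE : rho n = (step n ^+ 2 + step n) * d%:R.
  by rewrite /rho /step; field; rewrite addrC natr1.
rewrite /slope /offset rhoE /C.
set c := step n in c0 c1 *.
have d0 : 0 <= d%:R :> R by exact: ler0n.
have cc : 0 <= c - c ^+ 2 by nra.
have u1 : 0 <= (q * y) * (c - c ^+ 2) by rewrite !mulr_ge0.
have u2 : 0 <= (K * d%:R) * (c - c ^+ 2) by rewrite !mulr_ge0.
have u3 : 0 <= (q * d%:R) * (4 * c - (1 + c) * (c ^+ 2 + c)).
  by rewrite !mulr_ge0//; nra.
nra.
Qed.

End conditional_bound.

(** * Calculus of finite means *)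

Section has_mean.
Context {R : realType} {dO : measure_display} {Omega : measurableType dO}.
Variable P : probability Omega R.
Implicit Types (g h : Omega -> R) (m p c : R).

Definition has_mean h m : Prop :=
  P.-integrable [set: Omega] (EFin \o h) /\ (\int[P]_x (h x)%:E = m%:E)%E.

(* A real value of the integral rules out the junk value of +oo - oo. *)
Lemma has_meanP h m : measurable_fun [set: Omega] h ->
  (\int[P]_x (h x)%:E = m%:E)%E -> has_mean h m.
Proof.
move=> mh hm; split=> //.
have mE : measurable_fun [set: Omega] (EFin \o h) by exact/measurable_EFinP.
apply/integrableP; split=> //.
have := erefl (m%:E \is a fin_num); rewrite -{1}hm integralE fin_numB.
case/andP => fp fn.
rewrite (_ : (fun x => `|(EFin \o h) x|%E)
    = (fun x => (EFin \o h)^\+ x + (EFin \o h)^\- x)%E); last first.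
  by rewrite -[RHS]fune_abse.
rewrite ge0_integralD//.
- by rewrite lte_add_pinfty// ltey_eq ?fp ?fn.
- exact: measurable_funepos.
- exact: measurable_funeneg.
Qed.

Lemma has_mean_cst c : has_mean (fun=> c) c.
Proof.
split; first exact: finite_measure_integrable_cst.
by rewrite integral_cst//= probability_setT mule1.
Qed.

Lemma has_meanD g h m p :
  has_mean g m -> has_mean h p -> has_mean (fun x => g x + h x) (m + p).
Proof.
move=> [ig gm] [ih hp]; split; first exact: (integrableD _ ig ih).
by have := integralD_EFin measurableT ig ih; rewrite /= gm hp.
Qed.

Lemma has_meanZ c h m : has_mean h m -> has_mean (fun x => c * h x) (c * m).
Proof.
move=> [ih hm]; split; first exact: (integrableZl _ c ih).
by have := integralZl measurableT ih c; rewrite /= hm.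
Qed.

Lemma has_mean_sum n (h : 'I_n -> Omega -> R) (m : 'I_n -> R) :
  (forall i, has_mean (h i) (m i)) ->
  has_mean (fun x => \sum_(i < n) h i x) (\sum_(i < n) m i).
Proof.
elim: n h m => [|n IH] h m hm.
  rewrite big_ord0; under eq_fun do rewrite big_ord0.
  exact: has_mean_cst.
rewrite big_ord_recl; under eq_fun do rewrite big_ord_recl.
by apply: has_meanD => //; exact: IH.
Qed.

Lemma has_mean_le g h m p :
  has_mean g m -> has_mean h p -> (forall x, g x <= h x) -> m <= p.
Proof.
move=> [ig gm] [ih hp] gh; rewrite -lee_fin -gm -hp.
by apply: le_integral => // x _; rewrite lee_fin gh.
Qed.

End has_mean.

(** * Moments of the stochastic gradient and of one step from a fixed point *)

Section stochastic_gradient.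
Context {R : realType} {d : nat} {dO dX : measure_display}.
Context {Omega : measurableType dO} {X : measurableType dX}.
Context {P : probability Omega R}.
Variables (xi : {RV P >-> X}) (f : 'rV[R]_d -> X -> R) (F : 'rV[R]_d -> R).
Variables (mu L N : R) (wstar : 'rV[R]_d).
Hypothesis f_meas : forall v, measurable_fun [set: X] (f v).
Hypothesis f_diff : forall x v, differentiable (fun u => f u x) v.
Hypothesis F_diff : forall v, differentiable F v.
Hypothesis grad_unbiased : forall v (i : 'I_d),
  ('E_P[fun omega => (grad (fun u => f u (xi omega)) v 0 i)%R])%E
    = (grad F v 0 i)%:E.
Hypothesis mu_gt0 : 0 < mu.
Hypothesis F_sc : strongly_convex mu F.
Hypothesis L_gt0 : 0 < L.
Hypothesis f_smooth : forall x, smooth L (fun u => f u x).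
Hypothesis wstar_min : forall v, F wstar <= F v.
Hypothesis N_def : (N%:E =
  2%:E * 'E_P[fun omega =>
                (enorm (grad (fun u => f u (xi omega)) wstar) ^+ 2)%R])%E.

Definition sgrad v x : 'rV[R]_d := grad (fun u => f u x) v.

Lemma measurable_sgrad v i : measurable_fun [set: X] (fun x => sgrad v x 0 i).
Proof. exact: measurable_grad. Qed.

Lemma sgrad_mean v u :
  has_mean P (fun omega => inner (sgrad v (xi omega)) u) (inner (grad F v) u).
Proof.
apply: has_mean_sum => i.
under eq_fun do rewrite mulrC.
rewrite mulrC; apply: has_meanZ; apply: has_meanP.
  exact: (measurableT_comp (measurable_sgrad v i)).
by rewrite -grad_unbiased unlock.
Qed.

(** As [N] is real, the nonnegative expectation in [N_def] cannot be infinite. *)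
Lemma sgrad_opt_sqr_mean :
  has_mean P (fun omega => inner (sgrad wstar (xi omega)) (sgrad wstar (xi omega)))
    (N / 2).
Proof.
apply: has_meanP.
  apply: measurable_inner => i.
  exact: (measurableT_comp (measurable_sgrad wstar i)).
move: N_def; rewrite unlock; under eq_integral do rewrite enorm_sqr.
set I := (X in (2%:E * X)%E); have : (0 <= I)%E.
  by apply: integral_ge0 => omega _; rewrite lee_fin inner_ge0.
rewrite -/I; case: I => [s _|_|//].
- by rewrite -EFinM => -[->]; rewrite mulrC mulKf// pnatr_eq0.
- by rewrite gt0_muley.
Qed.

Let grad_opt : grad F wstar = 0.
Proof. exact: grad_min0. Qed.

(** This yields [4 <= E] later. At a unit vector [u] away from [wstar], the slope of [F] along [u]
    is at least [mu] by strong convexity and at most [L] by averaging the smoothness bound. *)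
Lemma mu_le_L : N != 0 -> mu <= L.
Proof.
move=> N0.
(* In dimension 0 every inner product vanishes and [N] would be 0; a positive dimension provides the
   unit vector. *)
have d_gt0 : (0 < d)%N.
  rewrite lt0n; apply: contra N0 => /eqP d0.
  have [_] := sgrad_opt_sqr_mean.
  have inner0 (u : 'rV[R]_d) : inner u u = 0.
    by rewrite /inner big1// => -[i ilt]; exfalso; rewrite d0 in ilt.
  under eq_integral do rewrite inner0.
  rewrite integral0 => -[/esym/eqP]; rewrite mulf_eq0 invr_eq0 pnatr_eq0 orbF.
  exact.
pose u : 'rV[R]_d := delta_mx 0 (Ordinal d_gt0).
have u1 : inner u u = 1.
  rewrite /inner (bigD1 (Ordinal d_gt0))//= !mxE !eqxx/= mulr1 big1 ?addr0// => i.
  by move=> /negbTE i0; rewrite !mxE eqxx/= i0 mulr0.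
pose v := wstar + u.
have vu : v - wstar = u by rewrite /v addrC addKr.
have /le_trans : mu <= inner (grad F v) u.
  by have := strongly_convex_min v F_sc grad_opt; rewrite vu u1 mulr1.
apply.
have -> : L = inner (grad F wstar) u + L.
  by rewrite grad_opt -[0 : 'rV[R]_d](scale0r 0) innerZl mul0r add0r.
apply: has_mean_le (sgrad_mean v u)
  (has_meanD (sgrad_mean wstar u) (has_mean_cst P L)) _.
move=> omega; rewrite -lerBlDl -innerBl.
have := smooth_sqr v wstar L_gt0 (f_smooth (xi omega)).
rewrite -/(sgrad v _) -/(sgrad wstar _) vu u1 mulr1.
set e := sgrad v _ - _ => eL.
(* Young with weight [L^-1] plays the part of Cauchy-Schwarz: 2 <e, u> <= |e|^2 / L + L <= 2 L. *)
have := inner_young e u (_ : 0 < L^-1); rewrite invr_gt0 => /(_ L_gt0).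
rewrite u1 mulr1 invrK => e_le.
have : L^-1 * inner e e <= L.
  by rewrite mulrC ler_pdivrMr// -expr2.
lra.
Qed.

Lemma sgrad_step_mean eta v : 0 <= eta -> 2 * L ^+ 2 * eta <= mu ->
  (\int[P]_omega
     (inner (v - eta *: sgrad v (xi omega) - wstar)
            (v - eta *: sgrad v (xi omega) - wstar))%:E
   <= ((1 - eta * mu) * inner (v - wstar) (v - wstar) + eta ^+ 2 * N)%:E)%E.
Proof.
move=> eta0 eta_le.
pose q := inner (v - wstar) (v - wstar).
have q0 : 0 <= q by exact: inner_ge0.
(* This is the mean of a pointwise majorant of the squared error. Strong convexity acts only on the
   mean: of the drift -2 eta mu q, half absorbs 2 eta^2 L^2 q by [eta_le]. *)
have [_ hm] := has_meanD (has_mean_cst P ((1 + 2 * eta ^+ 2 * L ^+ 2) * q))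
  (has_meanD (has_meanZ (- (2 * eta)) (sgrad_mean v (v - wstar)))
             (has_meanZ (2 * eta ^+ 2) sgrad_opt_sqr_mean)).
have bound : (1 + 2 * eta ^+ 2 * L ^+ 2) * q
    + (- (2 * eta) * inner (grad F v) (v - wstar) + 2 * eta ^+ 2 * (N / 2))
    <= (1 - eta * mu) * q + eta ^+ 2 * N.
  have := strongly_convex_min v F_sc grad_opt; rewrite -/q => scv.
  have scv' : eta * (mu * q) <= eta * inner (grad F v) (v - wstar).
    by rewrite ler_wpM2l.
  have : eta * q * (2 * L ^+ 2 * eta) <= eta * q * mu.
    by rewrite ler_wpM2l// mulr_ge0.
  lra.
rewrite -lee_fin in bound; apply: le_trans bound; rewrite -hm.
have m_sgrad u i : measurable_fun [set: Omega] (fun omega => sgrad u (xi omega) 0 i).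
  exact: (measurableT_comp (measurable_sgrad u i)).
have m_inner u : measurable_fun [set: Omega]
    (fun omega => inner (sgrad v (xi omega)) u).
  by apply: measurable_sum => i; apply: measurable_funM.
apply: ge0_le_integral => //.
- by move=> omega _; rewrite lee_fin inner_ge0.
- apply/measurable_EFinP; apply: measurable_inner => i.
  rewrite (_ : (fun _ => _)
      = (fun omega => v 0 i - eta * sgrad v (xi omega) 0 i - wstar 0 i)).
    do 2 (apply: measurable_funB => //); exact: measurable_funM.
  by apply/funext => omega; rewrite !mxE.
- apply/measurable_EFinP; apply: measurable_funD => //.
  apply: measurable_funD; apply: measurable_funM => //.
  exact: measurable_inner.
move=> omega _; rewrite lee_fin.
have := smooth_sqr v wstar L_gt0 (f_smooth (xi omega)).
rewrite -/(sgrad v _) -/(sgrad wstar _) -/q.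
set g := sgrad v _; set g' := sgrad wstar _ => gL.
have -> : v - eta *: g - wstar = (v - wstar) - eta *: g by rewrite addrAC.
rewrite innerB_sqr innerZr innerZl innerZr -/q (innerC _ g).
have := innerD_sqr_le (g - g') g' (@ltr01 R); rewrite subrK invr1 => gg.
have : eta ^+ 2 * inner g g
    <= eta ^+ 2 * (2 * (L ^+ 2 * q) + 2 * inner g' g').
  by rewrite ler_wpM2l ?sqr_ge0//; lra.
lra.
Qed.

End stochastic_gradient.

(** * Adaptedness of the iterates and regularity of the update *)

Section iterates.
Context {R : realType} {d : nat} {dO dX : measure_display}.
Context {Omega : measurableType dO} {X : measurableType dX}.
Context {P : probability Omega R}.
Variables (xis : nat -> {RV P >-> X}) (f : 'rV[R]_d -> X -> R).
Variables (L : R) (eta : nat -> R) (w0 : 'rV[R]_d) (w : nat -> Omega -> 'rV[R]_d).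
Hypothesis f_meas : forall v, measurable_fun [set: X] (f v).
Hypothesis f_diff : forall x v, differentiable (fun u => f u x) v.
Hypothesis L_gt0 : 0 < L.
Hypothesis f_smooth : forall x, smooth L (fun u => f u x).
Hypothesis w_init : forall omega, w 0%N omega = w0.
Hypothesis w_step : forall t omega,
  w t.+1 omega = w t omega - eta t *: sgrad f (w t omega) (xis t omega).

(** Passing to [t.+1] brings in [xis t], which generates cylinders of [t.+1]; [w t] itself uses only
    earlier draws, so [xis t] is independent of it. *)
Lemma iterate_adapted t i :
  measurable_fun [set: g_sigma_algebraType (cylinders xis t)]
    (fun omega => w t omega 0 i).
Proof.
elim: t i => [|t IH] i.
  under eq_fun do rewrite w_init.
  exact: measurable_cst.
have mw j : measurable_fun [set: g_sigma_algebraType (cylinders xis t.+1)]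
    (fun omega => w t omega 0 j).
  move=> _ B mB; have := IH j measurableT B mB.
  apply: sub_smallest2r => //; exact: cylinders_succ.
have mxi : measurable_fun [set: g_sigma_algebraType (cylinders xis t.+1)]
    (xis t : g_sigma_algebraType (cylinders xis t.+1) -> X).
  move=> _ B mB; rewrite setTI; apply: sub_sigma_algebra.
  exact: cylinders_last.
rewrite (_ : (fun _ => _) = (fun omega =>
    w t omega 0 i - eta t * sgrad f (w t omega) (xis t omega) 0 i)); last first.
  by apply/funext => omega; rewrite w_step 3!mxE.
apply: measurable_funB => //; apply: measurable_funM => //.
apply: (measurable_lipschitz_comp (h := fun v x => sgrad f v x 0 i)
  (K := L ^+ 2)) => //.
- by move=> v; exact: measurable_sgrad.
- exact: sqr_ge0.
move=> x u v; apply: le_trans (smooth_sqr _ _ L_gt0 (f_smooth x)).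
by have := sqr_coord_le (sgrad f u x - sgrad f v x) i; rewrite !mxE.
Qed.

(** The constant enters [conditional_bound] only through the vanishing mesh error, so the crude
    factor 2 costs nothing. *)
Lemma sgd_map_lipschitz e a x u v :
  inner ((u - e *: sgrad f u x - a) - (v - e *: sgrad f v x - a))
        ((u - e *: sgrad f u x - a) - (v - e *: sgrad f v x - a))
    <= (2 + 2 * (e ^+ 2 * L ^+ 2)) * inner (u - v) (u - v).
Proof.
rewrite (_ : _ - _ - (v - _ - _)
  = (u - v) + (- e) *: (sgrad f u x - sgrad f v x)); last first.
  by apply/rowP => i; rewrite !mxE; ring.
apply: le_trans (innerD_sqr_le _ _ (@ltr01 R)) _.
rewrite invr1 innerZl innerZr.
have : e ^+ 2 * inner (sgrad f u x - sgrad f v x) (sgrad f u x - sgrad f v x)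
    <= e ^+ 2 * (L ^+ 2 * inner (u - v) (u - v)).
  by rewrite ler_wpM2l ?sqr_ge0//; exact: smooth_sqr.
lra.
Qed.

End iterates.

(** * Assembling the convergence rate *)

Theorem theorem4 (R : realType) (d : nat)
  (dO dX : measure_display)
  (Omega : measurableType dO) (X : measurableType dX)
  (P : probability Omega R)
  (xi : {RV P >-> X}) (xis : nat -> {RV P >-> X})
  (f : 'rV[R]_d -> X -> R) (F : 'rV[R]_d -> R)
  (mu L N alpha kappa E T : R) (eta : nat -> R)
  (w0 wstar : 'rV[R]_d) (w : nat -> Omega -> 'rV[R]_d)
  (* the stochastic objective *)
  (f_meas : forall v, measurable_fun [set: X] (f v))
  (f_diff : forall x v, differentiable (fun u => f u x) v)
  (F_def : forall v, (F v)%:E = ('E_P[fun omega => f v (xi omega)])%E)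
  (F_diff : forall v, differentiable F v)
  (grad_unbiased : forall v (i : 'I_d),
     ('E_P[fun omega => (grad (fun u => f u (xi omega)) v 0 i)%R])%E
       = (grad F v 0 i)%:E)
  (* assumptions on the objective *)
  (mu_gt0 : 0 < mu)
  (F_sc : strongly_convex mu F)
  (L_gt0 : 0 < L)
  (f_smooth : forall x, smooth L (fun u => f u x))
  (wstar_min : forall v, F wstar <= F v)
  (kappa_def : kappa = L / mu)
  (N_def : N%:E =
     (2%:E * 'E_P[fun omega =>
                    (enorm (grad (fun u => f u (xi omega)) wstar) ^+ 2)%R])%E)
  (N_gt0 : 0 < N)
  (* the algorithm *)
  (alpha_def : alpha = 2)
  (E_def : E = 2 * alpha * L * kappa / mu)
  (eta_def : forall t, eta t = alpha / (mu * (t%:R + E)))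
  (xis_iid : iid_copies xi xis)
  (w_init : forall omega, w 0%N omega = w0)
  (w_step : forall t omega,
     w t.+1 omega =
       w t omega - eta t *: grad (fun u => f u (xis t omega)) (w t omega))
  (T_def : T = 4 * L * kappa / mu
                 * Num.max (L * kappa * mu / N * enorm (w0 - wstar) ^+ 2) 1
               - 4 * L * kappa / mu) :
  (forall t, eta t <= eta 0%N) /\
  eta 0%N = 1 / (2 * L * kappa) /\
  (forall t : nat, T <= t%:R ->
     ('E_P[fun omega => (enorm (w t omega - wstar) ^+ 2)%R]
        <= (4 * alpha ^+ 2 * N / mu ^+ 2 * (1 / (t%:R - T + E)))%R%:E)%E).
Proof.
have N_neq0 : N != 0 by rewrite gt_eqF.
have mu_le : mu <= L.
  exact: (@mu_le_L _ _ _ _ _ _ _ xi f F mu L N wstar).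
have kappaE : L * kappa = L ^+ 2 / mu by rewrite kappa_def mulrA -expr2.
have EE : E = 4 * (L / mu) ^+ 2.
  by rewrite E_def alpha_def kappa_def; field; rewrite gt_eqF.
have E4 : 4 <= E.
  have Lmu : 1 <= L / mu by rewrite ler_pdivlMr// mul1r.
  by rewrite EE; nra.
have s_gt0 t : 0 < t%:R + E by rewrite ltr_wpDl//; lra.
have eta_mu t : eta t * mu = 2 / (t%:R + E).
  by rewrite eta_def alpha_def; field; rewrite !gt_eqF.
have eta_ge0 t : 0 <= eta t.
  rewrite eta_def alpha_def divr_ge0//.
  by apply: mulr_ge0; exact: ltW.
have eta_le t : eta t <= eta 0%N.
  rewrite !eta_def add0r alpha_def ler_wpM2l// lef_pV2 ?posrE ?mulr_gt0//; last lra.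
  by rewrite ler_pM2l// lerDr.
have eta0E : eta 0%N = 1 / (2 * L * kappa).
  by rewrite eta_def add0r alpha_def EE kappa_def; field; rewrite !gt_eqF.
split=> //; split=> //.
(* Equality holds at [t = 0], where the step is mu / (2 L^2); later steps are no larger. *)
have eta_small t : 2 * L ^+ 2 * eta t <= mu.
  apply: (@le_trans _ _ (2 * L ^+ 2 * eta 0%N)).
    by rewrite ler_wpM2l// mulr_ge0 ?sqr_ge0.
  rewrite eta0E kappa_def le_eqVlt; apply/orP; left; apply/eqP.
  by field; rewrite !gt_eqF.
pose Y t omega := inner (w t omega - wstar) (w t omega - wstar).
have step t y : (\int[P]_omega (Y t omega)%:E = y%:E)%E ->
    (\int[P]_omega (Y t.+1 omega)%:E
      <= ((1 - eta t * mu) * y + eta t ^+ 2 * N)%:E)%E.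
  move=> Yt.
  have adapted := @iterate_adapted _ _ _ _ _ _ _ xis f L eta w0 w f_meas f_diff
    L_gt0 f_smooth w_init w_step t.
  pose S v x := v - eta t *: sgrad f v x - wstar.
  rewrite (_ : (fun omega => (Y t.+1 omega)%:E) = (fun omega =>
    (inner (S (w t omega) (xis t omega)) (S (w t omega) (xis t omega)))%:E)); last first.
    by apply/funext => omega; rewrite /Y w_step.
  apply: (@conditional_bound _ _ _ _ _ _ P xi (xis t) (w t) S wstar
    (2 + 2 * (eta t ^+ 2 * L ^+ 2))) Yt.
  - move=> i _ B mB; exact: history_measurable (adapted i measurableT B mB).
  - move=> v i; rewrite (_ : (fun _ => _)
      = (fun x => v 0 i - eta t * sgrad f v x 0 i - wstar 0 i)); last first.
      by apply/funext => x; rewrite !mxE.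
    do 2 (apply: measurable_funB => //); apply: measurable_funM => //.
    exact: measurable_sgrad.
  - by move=> x u v; exact: sgd_map_lipschitz.
  - move=> n k B mB; apply: (independent_history xis_iid) => //.
    exact: (measurable_cell n k adapted).
  - by rewrite addr_ge0// mulr_ge0// mulr_ge0 ?sqr_ge0.
  - rewrite subr_ge0 eta_mu ler_pdivrMr// mul1r.
    have : 0 <= t%:R :> R by exact: ler0n.
    lra.
  - by rewrite mulr_ge0 ?sqr_ge0// ltW.
  - move=> v; exact: (@sgrad_step_mean _ _ _ _ _ _ _ xi f F mu L N wstar).
pose y t := fine (\int[P]_omega (Y t omega)%:E)%E.
have Y_ge0 t : (0 <= \int[P]_omega (Y t omega)%:E)%E.
  by apply: integral_ge0 => omega _; rewrite lee_fin inner_ge0.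
have Y0 : (\int[P]_omega (Y 0%N omega)%:E = (enorm (w0 - wstar) ^+ 2)%:E)%E.
  under eq_integral do rewrite /Y w_init -enorm_sqr.
  by rewrite integral_cst//= probability_setT mule1.
(* [fine] sends an infinite integral to 0, so finiteness is proved by induction: [step] bounds each
   integral by a real number. *)
have yE t : (\int[P]_omega (Y t omega)%:E = (y t)%:E)%E.
  rewrite /y fineK//; elim: t => [|t IH]; first by rewrite Y0.
  rewrite ge0_fin_numE//; move: IH => /fineK /esym /step /le_lt_trans; apply.
  exact: ltry.
move=> t tT.
rewrite unlock; under eq_integral do rewrite enorm_sqr.
rewrite yE lee_fin.
pose M := Num.max (L * kappa * mu / N * enorm (w0 - wstar) ^+ 2) 1.
(* For [alpha = 2] the factor 4 L kappa / mu in [T] is exactly [E]. *)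
have TE : T = E * (M - 1).
  by rewrite T_def -/M E_def alpha_def; field; rewrite gt_eqF.
rewrite TE in tT *.
have -> : 4 * alpha ^+ 2 * N / mu ^+ 2 * (1 / (t%:R - E * (M - 1) + E))
    = 4 * (4 * N / mu ^+ 2) / (t%:R - E * (M - 1) + E).
  by rewrite alpha_def mul1r; congr (_ / _); field; rewrite gt_eqF.
have b0 : 0 <= 4 * N / mu ^+ 2.
  by rewrite divr_ge0 ?sqr_ge0// mulr_ge0// ltW.
apply: (@diminishing_step_rate _ y) => //.
- by rewrite le_max lexx orbT.
- by rewrite fine_ge0.
- rewrite {1}/y Y0 /= EE.
  (* With b = 4 N / mu^2, the first argument of the maximum is E y_0 / b. *)
  apply: (@le_trans _ _ (4 * N / mu ^+ 2 *
      (L * kappa * mu / N * enorm (w0 - wstar) ^+ 2))).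
    rewrite kappa_def le_eqVlt; apply/orP; left; apply/eqP.
    by field; rewrite !gt_eqF.
  by rewrite ler_wpM2l// le_max lexx.
move=> k; have := step k _ (yE k); rewrite yE lee_fin eta_mu => /le_trans; apply.
rewrite lerD2l (_ : eta k = 2 / (k%:R + E) / mu); last first.
  by rewrite -eta_mu mulfK// gt_eqF.
rewrite le_eqVlt; apply/orP; left; apply/eqP.
by field; rewrite !gt_eqF.
Qed.
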